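(* The polynomial $R$ of twisted graph diagrams is invariant under the virtual Reidemeister move V$^*$: if twisted graph diagrams $E$ and $E'$ differ by one such move, then $R(E)=R(E')$.
   Context: Graphs are finite, may be disconnected, may have loops and multiple edges, and may have circle components (components homeomorphic to a circle and without vertices). A twisted graph diagram is a diagram of a graph in $\mathbb{R}^2$ whose multiple points are transverse double points away from vertices, each being either a classical crossing (with over/under information) or a virtual crossing (no such information), with finitely many bars (short transverse marks) on edges or circle components. It is pure if it has no classical crossings. Surface of a pure diagram. For a pure twisted graph diagram $E$ without circle components let $S$ be the compact surface with a disk for each vertex and a band for each edge, the bands attached to the vertex disks in the cyclic order in which the edges leave the vertex in the plane, a band having a half twist for each bar on its edge (relative to the planar orientation of the disks); virtual crossings are ignored (bands pass each other without meeting). Let $k(S)$ be the number of connected components, $n(S)$ the first Betti number, $b(S)$ the number of boundary components, and $t(S)=0$ if $S$ is orientable, $t(S)=1$ otherwise. Put $M(\emptyset)=1$ and $$M(E)=(-1)^{k(S)}y^{n(S)}z^{k(S)-b(S)+n(S)}w^{t(S)}\in\mathbb{Z}[y,z,w]/(w^2-w).$$ For a pure twisted graph diagram $F$ let $o(F)$, resp. $e(F)$, be the number of circle components with an odd, resp. even (possibly zero), number of bars. Put $Q(\emptyset)=1$ and $$Q(F)(y,z,w)=(-1-y)^{e(F)}(-1-yzw)^{o(F)}\sum_{E\subset F}M(E),$$ the sum being over all subdiagrams $E$ given by spanning subgraphs (all vertices, any subset of edges) of $F$ with its circle components removed. States. At a classical crossing whose over-strand joins the ends SW and NE and whose under-strand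 joins NW and SE: spin $+1$ replaces it by two disjoint arcs joining SW to NW and SE to NE; spin $-1$ by two disjoint arcs joining SW to SE and NW to NE; spin $0$ by a vertex of degree 4. A state $S$ of a twisted graph diagram $E$ is the pure twisted graph diagram obtained by choosing a spin at every classical crossing; $\mathcal{S}(E)$ is the set of states, and $\{E\mid S\}:=a^{p-q}$ where $p,q$ are the numbers of crossings with spin $+1$, $-1$. Define $$R(E)(a,z,w)=\sum_{S\in\mathcal{S}(E)}\{E\mid S\}\,Q(S)(-a-2-a^{-1},z,w)\in\mathbb{Z}[a^{\pm1},z,w]/(w^2-w).$$ Move V$^*$ (inside a disk, diagram unchanged outside): a strand that meets the two strands of a classical crossing only in virtual crossings is moved across that classical crossing. *)

(* Defs.v *)
From HB Require Import structures.
From mathcomp Require Import all_boot all_order all_algebra.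

Set Implicit Arguments.
Unset Strict Implicit.
Unset Printing Implicit Defensive.

Import GRing.Theory.

(* A diagram is encoded by the rotation system of the plane graph cut out by its
   vertices, crossings and bars.  The darts are the ends, at these nodes, of the
   segments into which the nodes cut the diagram.  This determines the diagram up
   to plane isotopy, except for the choice of the unbounded region and, when the
   plane graph is disconnected, the regions in which its components are placed;
   neither enters the polynomials below.

   A [Plain] node carries no information: its darts are the ends of arcs passing
   through unchanged, matched in pairs by the rotation.  A diagram has one, of
   degree 2, on each circle component that meets no crossing and no bar; a
   smoothed crossing is a [Plain] node of degree 4, i.e. two arcs. *)
Inductive kind := Vertex | Classical | Virtual | Bar | Plain.

Definition nat_of_kind (k : kind) : nat :=
  match k with Vertex => 0 | Classical => 1 | Virtual => 2 | Bar => 3 | Plain => 4 end.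

Definition kind_of_nat (n : nat) : kind :=
  match n with 0 => Vertex | 1 => Classical | 2 => Virtual | 3 => Bar | _ => Plain end.

Lemma nat_of_kindK : cancel nat_of_kind kind_of_nat. Proof. by case. Qed.

HB.instance Definition _ := Equality.copy kind (can_type nat_of_kindK).

Inductive spin := Pos | Neg | Zero.

Definition option_of_spin (s : spin) : option bool :=
  match s with Pos => Some true | Neg => Some false | Zero => None end.

Definition spin_of_option (o : option bool) : spin :=
  match o with Some true => Pos | Some false => Neg | None => Zero end.

Lemma option_of_spinK : cancel option_of_spin spin_of_option.
Proof. by case. Qed.

HB.instance Definition _ := Finite.copy spin (can_type option_of_spinK).

Record rotsys := Rotsys {
  dart : finType;
  node : finType;
  base : dart -> node;        (* the node at which a dart sits *)
  opp : dart -> dart;         (* the other end of the same segment *)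
  rot : dart -> dart;         (* the next dart counterclockwise around the node *)
  kindof : node -> kind;
  over : pred dart            (* ends of the over-strand; read at classical crossings only *)
}.

Definition at_kind (E : rotsys) (k : kind) (d : dart E) : bool :=
  kindof (base d) == k.

Section Wellformed.

Variable E : rotsys.

Definition degree (x : node E) : nat := #|[set d | base d == x]|.

Definition face (d : dart E) : dart E := rot (opp d).

Definition link : rel (dart E) := [rel d d' | (d' == opp d) || (d' == rot d)].

(* Euler's formula, which forces genus 0 for each connected component; vertices
   of degree 0 have no darts and are irrelevant here. *)
Definition planar : Prop :=
  fcard (@rot E) (dart E) + fcard face (dart E) + fcard (@opp E) (dart E)
    = #|dart E| + 2 * n_comp link (dart E).

Record wellformed : Prop := Wellformed {
  opp_invol : involutive (@opp E);
  opp_free : forall d : dart E, opp d != d;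
  rot_inj : injective (@rot E);
  rot_node : forall d d' : dart E, fconnect (@rot E) d d' = (base d == base d');
  degree_crossing : forall x : node E,
    kindof x \in [:: Classical; Virtual] -> degree x = 4;
  degree_mark : forall x : node E,
    kindof x \in [:: Bar; Plain] -> degree x = 2;
  over_alternates : forall d : dart E,
    at_kind Classical d -> over (rot d) = ~~ over d;
  plain_circle : forall d : dart E, at_kind Plain d -> opp d = rot d;
  euler_planar : planar
}.

End Wellformed.

Record diagram := Diagram { code :> rotsys; codeP : wellformed code }.

Section Pure.

Variable F : rotsys.

(* The end by which a strand entering a node at [d] leaves it; strands stop at
   vertices. *)
Definition thru (d : dart F) : dart F :=
  match kindof (base d) with
  | Vertex => d
  | Classical | Virtual => rot (rot d)
  | Bar | Plain => rot d
  end.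

Definition along : rel (dart F) := [rel d d' | (d' == opp d) || (d' == thru d)].

(* A strand is a whole edge or a whole circle component, given as the set of all
   darts on it. *)
Definition strands : {set {set dart F}} :=
  [set [set d' | connect along d d'] | d in dart F].

Definition edges : {set {set dart F}} :=
  [set C in strands | [exists d in C, at_kind Vertex d]].

Definition circles : {set {set dart F}} := strands :\: edges.

Definition bars (C : {set dart F}) : nat :=
  #|[set x | (kindof x == Bar) && [exists d in C, base d == x]]|.

Definition odd_circles : nat := #|[set C in circles | odd (bars C)]|.
Definition even_circles : nat := #|[set C in circles | ~~ odd (bars C)]|.

(* The surface of the spanning subgraph with edge set A. *)
Section Surface.

Variable A : {set {set dart F}}.

Definition vertices : {set node F} := [set x | kindof x == Vertex].

(* The ends of the bands on the disks. *)
Definition band_end (h : dart F) : bool := at_kind Vertex h && (h \in cover A).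

(* [h] and [h'] are the two ends of the band of [C]. *)
Definition band (C : {set dart F}) (h h' : dart F) : bool :=
  [&& C \in A, h \in C, h' \in C, h != h', at_kind Vertex h & at_kind Vertex h'].

Definition adjacent : rel (node F) := fun x y =>
  [exists C, exists h, exists h', [&& band C h h', base h == x & base h' == y]].

Definition surf_k : nat := n_comp adjacent vertices.

(* First Betti number: the disks and bands give Euler characteristic
   #|vertices| - #|A|, which is b_0 - b_1 because each component of the surface
   has nonempty boundary, so that b_2 = 0.  The subtraction is exact. *)
Definition surf_n : nat := #|A| + surf_k - #|vertices|.

(* The next band end counterclockwise around the disk ([h] itself if alone). *)
Definition next_end (h : dart F) : dart F :=
  head h [seq d <- traject (@rot F) (rot h) (order (@rot F) h) | band_end d].

(* The boundary of the surface consists of the sides of the bands, of the arcs of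
   the disk boundaries between consecutive bands, and of the boundaries of the
   disks without bands.  The corner (h, true), resp. (h, false), is the endpoint
   of the attaching arc of the band end h on its left, resp. right, as seen by an
   observer leaving the disk along h.  An untwisted side joins left to right. *)
Definition corner : finType := (dart F * bool)%type.

Definition band_side : rel corner := fun c c' =>
  [exists C, band C c.1 c'.1 && (c'.2 == (~~ c.2) (+) odd (bars C))].

Definition disk_arc : rel corner := fun c c' =>
  [&& band_end c.1, c.2, c'.1 == next_end c.1 & ~~ c'.2].

Definition boundary_step : rel corner := fun c c' =>
  [|| band_side c c', disk_arc c c' | disk_arc c' c].

Definition surf_b : nat :=
  n_comp boundary_step [pred c : corner | band_end c.1]
  + #|[set x in vertices | [forall h, band_end h ==> (base h != x)]]|.

(* Orientations of the disks (true: the planar one) that extend over all bands: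
   a band with an odd number of half twists must join opposite orientations. *)
Definition orientable : bool :=
  [exists o : {ffun node F -> bool}, forall C, forall h, forall h',
     band C h h' ==> (o (base h) (+) o (base h') == odd (bars C))].

Definition surf_t : nat := ~~ orientable.

End Surface.

Local Open Scope ring_scope.

Variables (P : comNzRingType) (y z w : P).

(* The exponent of z is the nonnegative integer k - b + n. *)
Definition M (A : {set {set dart F}}) : P :=
  (-1) ^+ surf_k A * y ^+ surf_n A
  * z ^+ (surf_k A + surf_n A - surf_b A)%N * w ^+ surf_t A.

Definition Q : P :=
  (- 1 - y) ^+ even_circles * (- 1 - y * z * w) ^+ odd_circles
  * \sum_(A : {set {set dart F}} | A \subset edges) M A.

End Pure.

Section States.

Variable E : rotsys.

Definition crossing : finType := {x : node E | kindof x == Classical}.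

Definition spins : finType := {ffun crossing -> spin}.

Definition spin_at (s : spins) (x : node E) : option spin := omap s (insub x).

(* With the over-strand SW-NE, the counterclockwise order is NE, NW, SW, SE.
   Spin +1 joins each over end to the end following it clockwise (SW-NW, NE-SE),
   spin -1 to the end following it counterclockwise (SW-SE, NE-NW).  At a node of
   degree 4, [iter 3 rot] is the clockwise rotation. *)
Definition state_rot (s : spins) (d : dart E) : dart E :=
  match spin_at s (base d) with
  | Some Pos => if over d then iter 3 (@rot E) d else rot d
  | Some Neg => if over d then rot d else iter 3 (@rot E) d
  | Some Zero | None => rot d
  end.

Definition state_kind (s : spins) (x : node E) : kind :=
  match spin_at s x with
  | Some Zero => Vertex
  | Some _ => Plain
  | None => kindof x
  end.

Definition state (s : spins) : rotsys :=
  @Rotsys (dart E) (node E) (@base E) (@opp E) (state_rot s) (state_kind s) (@over E).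

Definition spin_sum (s : spins) : int :=
  #|[set c | s c == Pos]|%:Z - #|[set c | s c == Neg]|%:Z.

End States.

(* The ring Z[a^{+-1}, z, w] / (w^2 - w), inside K[w] / (w^2 - w) for the fraction
   field K of Z[a, z]. *)

Local Open Scope ring_scope.

Definition coefK : fieldType := {fraction {poly {poly int}}}.
Definition aK : coefK := tofrac ('X%:P : {poly {poly int}}).
Definition zK : coefK := tofrac ('X : {poly {poly int}}).

Definition idem_poly : {poly coefK} := 'X^2 - 'X.
Definition Rring : comAlgType coefK := {poly %/ idem_poly}.
Definition zR : Rring := zK%:A.
Definition wR : Rring := in_qpoly idem_poly 'X.

Definition R (E : diagram) : Rring :=
  \sum_(s : spins E)
     (aK ^ spin_sum s) *: Q (state s) ((- aK - 2 - aK^-1)%:A : Rring) zR wR.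

Section Move.

Variable E : rotsys.

(* The disk of the move: x, y, z are the sides, directed counterclockwise, of a
   triangular face with corners a classical crossing and two virtual crossings;
   the strand through y is the one that moves. *)
Record triangle (x y z : dart E) : Prop := Triangle {
  triangle_x : rot x = opp z;
  triangle_y : rot y = opp x;
  triangle_z : rot z = opp y;
  classical_x : at_kind Classical x;
  virtual_y : at_kind Virtual y;
  virtual_z : at_kind Virtual z;
  corners_yz : base y != base z
}.

Variables x y z : dart E.

Definition inner : {set dart E} := [set x; y; z; opp x; opp y; opp z].

(* Each of the three strands p - c - c' - p' in the disk becomes p - c' - c - p':
   the end of c towards p is exchanged with the end of c' towards c, and the end
   of c' towards p' with the end of c towards c'.  The crossings, their cyclic
   orders and everything outside of the disk are kept; this turns the triangle by
   half a turn. *)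
Definition exchange (d : dart E) : dart E :=
  if d \in inner then rot (rot (opp d))
  else if rot (rot d) \in inner then opp (rot (rot d))
  else d.

Definition slide : rotsys :=
  @Rotsys (dart E) (node E) (@base E) (fun d => exchange (opp (exchange d)))
       (@rot E) (@kindof E) (@over E).

End Move.

(* Equality up to renaming of darts and nodes, i.e. up to plane isotopy. *)
Definition isomorphic (E E' : rotsys) : Prop :=
  exists (f : dart E -> dart E') (g : node E -> node E'),
    [/\ bijective f, bijective g &
     [/\ forall d, base (f d) = g (base d),
         forall d, opp (f d) = f (opp d),
         forall d, rot (f d) = f (rot d),
         forall n, kindof (g n) = kindof n &
         forall d, at_kind Classical d -> over (f d) = over d]].

Definition Vstar (E E' : diagram) : Prop :=
  exists x y z : dart E, triangle x y z /\ isomorphic (slide x y z) E'.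

(* Main.v *)
From mathcomp Require Import all_boot all_order all_algebra.
Require Import Defs.

Set Implicit Arguments.
Unset Strict Implicit.
Unset Printing Implicit Defensive.

(* The move keeps the set of crossings, so states correspond bijectively, and it
   suffices to compare [Q] state by state.  [Q] only sees how the strands of the
   state partition the darts at vertices and bars.  Each side of the triangle
   through the classical corner keeps its two classical ends joined to the same
   outer ends, because the virtual crossing that it passes first or last is
   invisible to strands.  So, once the four virtual darts lying on those two sides
   are discarded, the strands before and after the move induce the same partition
   of the remaining darts. *)

(** * Transport of connectivity and of component counts *)

Lemma connect_homo (T T' : finType) (e : rel T) (e' : rel T') (f : T -> T') :
  (forall x y, e x y -> connect e' (f x) (f y)) ->
  forall x y, connect e x y -> connect e' (f x) (f y).
Proof.
move=> homo x _ /connectP[p pP ->]; elim: p x pP => //= y p IHp x /andP[xy /IHp].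
exact/connect_trans/homo.
Qed.

Section RelBijection.

Variables (T T' : finType) (e : rel T) (e' : rel T') (f : T -> T').
Hypotheses (f_bij : bijective f) (f_rel : forall x y, e' (f x) (f y) = e x y).

Lemma connect_bij x y : connect e' (f x) (f y) = connect e x y.
Proof.
have [f' fK f'K] := f_bij; apply/idP/idP; last first.
  by apply: connect_homo => u v uv; rewrite connect1 // f_rel.
rewrite -[in X in _ -> X](fK x) -[in X in _ -> X](fK y).
by apply: connect_homo => u v; rewrite -[u]f'K -[v]f'K f_rel !fK => /connect1.
Qed.

(** A bijection compatible with the relations is an adjunction between their connectivities, and
    adjunctions preserve component counts on closed sets. *)
Lemma n_comp_bij (a : {pred T}) (a' : {pred T'}) :
  connect_sym e -> connect_sym e' -> closed e' a' ->
  (forall x, (f x \in a') = (x \in a)) -> n_comp e a = n_comp e' a'.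
Proof.
move=> sym_e sym_e' cl_a' fa; have [f' fK f'K] := f_bij.
rewrite (adjunction_n_comp f sym_e' sym_e cl_a').
  by apply: eq_n_comp_r => x; rewrite !inE fa.
split=> [x' _|x y _]; last by rewrite connect_bij.
by exists (f' x'); rewrite f'K connect0.
Qed.

End RelBijection.

(** * Symmetry and closedness of the relations that define the surface *)

Section SurfaceRelations.

Variables (G : rotsys) (B : {set {set dart G}}).

Lemma adjacent_sym : symmetric (adjacent B).
Proof.
suff sub x y : adjacent B x y -> adjacent B y x by move=> x y; apply/idP/idP; apply: sub.
case/existsP=> C /existsP[h /existsP[h' /and3P[/and5P[BC Ch Ch' hh' /andP[kh kh']] hx h'y]]].
apply/existsP; exists C; apply/existsP; exists h'; apply/existsP; exists h.
by rewrite /band BC Ch Ch' eq_sym hh' kh kh' hx h'y.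
Qed.

Lemma adjacent_closed :
  closed (adjacent B) (mem (vertices G)).
Proof.
move=> x y /existsP[C /existsP[h /existsP[h' /and3P[/and5P[_ _ _ _ /andP[kh kh']]]]]].
by move=> /eqP <- /eqP <-; rewrite !inE; rewrite /at_kind in kh kh'; rewrite kh kh'.
Qed.

Lemma boundary_step_sym :
  symmetric (boundary_step B).
Proof.
move=> [h l] [h' l']; rewrite /boundary_step [disk_arc _ _ _ || _]orbC.
congr (_ || _); apply: eq_existsb => C /=; rewrite /band (eq_sym h).
congr (_ && _); last by case: l l' (odd _) => [] [] [].
by rewrite (andbCA (h \in C)) (andbC (at_kind _ h)).
Qed.

Lemma boundary_step_closed :
  closed (boundary_step B) [pred c : corner G | band_end B c.1].
Proof.
apply: intro_closed; first exact/sym_connect_sym/boundary_step_sym.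
move=> [h l] [h' l']; rewrite !inE /= => /or3P[|/and4P[/= _ _ /eqP -> _] bh|/and4P[]] //.
  case/existsP=> C /andP[/and5P[BC Ch Ch' hh' /= /andP[kh kh']] _] _.
  by rewrite /band_end kh'; apply/bigcupP; exists C.
(* If the filtered list is empty, the default [h] is a band end by [bh]; otherwise its first entry
   is one. *)
rewrite /next_end; set s := filter _ _.
have : all (band_end B) s by apply: filter_all.
by case: s => //= d s /andP[].
Qed.

End SurfaceRelations.

(* Two pure codes with corresponding darts, nodes and rotations have the same [Q]
   once their strands meet a set [T] of darts in corresponding subsets, where [T]
   meets every strand and contains all darts at vertices and bars. *)
Section Transfer.

Variables (F F' : rotsys) (f : dart F -> dart F') (g : node F -> node F').
Variable T : {pred dart F}.
Hypotheses (f_bij : bijective f) (g_bij : bijective g).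
Hypothesis f_base : forall d, base (f d) = g (base d).
Hypothesis f_rot : forall d, rot (f d) = f (rot d).
Hypothesis g_kind : forall x, kindof (g x) = kindof x.
Hypotheses (along_sym : connect_sym (@along F)) (along_sym' : connect_sym (@along F')).
Hypothesis f_along : {in T &, forall d e,
  connect (@along F') (f d) (f e) = connect (@along F) d e}.
Hypothesis T_meets : forall d, exists2 e, e \in T & connect (@along F) d e.
Hypothesis T_meets' : forall d', exists2 e, e \in T & connect (@along F') d' (f e).
Hypothesis T_kind : forall d, kindof (base d) \in [:: Vertex; Bar] -> d \in T.

Let f_inj := bij_inj f_bij.
Let g_inj := bij_inj g_bij.

(** * Correspondence of strands, edges and circles *)

Let strand d : {set dart F} := [set e | connect (@along F) d e].
Let strand' d' : {set dart F'} := [set e | connect (@along F') d' e].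

(** Outside [T] the map [f] may send darts of one strand to different strands, so only the darts in
    [T] are carried over, and their images are then completed to whole strands. *)
Definition strand_map (C : {set dart F}) : {set dart F'} :=
  [set d' | [exists d in C, (d \in T) && connect (@along F') (f d) d']].

Lemma strand_mapE d : d \in T -> strand_map (strand d) = strand' (f d).
Proof.
move=> Td; apply/setP => d'; rewrite !inE.
apply/exists_inP/idP => [[e]|dd']; last by exists d; rewrite ?inE ?Td.
by rewrite inE => de /andP[Te]; apply: connect_trans; rewrite f_along.
Qed.

Lemma strand_repr C : C \in strands F -> exists2 d, d \in T & C = strand d.
Proof.
case/imsetP=> d _ ->; have [e Te de] := T_meets d; exists e => //.
by apply/setP => u; rewrite !inE (same_connect along_sym de).
Qed.

Lemma mem_strand_map C d :
  C \in strands F -> d \in T -> (f d \in strand_map C) = (d \in C).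
Proof. by case/strand_repr=> e Te -> Td; rewrite strand_mapE // !inE f_along. Qed.

Lemma strand_map_inj : {in strands F &, injective strand_map}.
Proof.
move=> C D sC sD eqCD; have [d Td Cd] := strand_repr sC.
have [e Te De] := strand_repr sD; have : d \in D.
  by rewrite -mem_strand_map // -eqCD mem_strand_map // Cd inE.
rewrite Cd De inE => ed; apply/setP => u.
by rewrite !inE (same_connect along_sym ed).
Qed.

(** Surjectivity rests on [T_meets']: every strand of [F'] contains the image of a dart in [T]. *)
Lemma strands_map : strands F' = strand_map @: strands F.
Proof.
apply/setP => C'; apply/imsetP/imsetP => [[d' _ ->]|[C sC ->]].
  have [e Te d'e] := T_meets' d'; exists (strand e); first exact: imset_f.
  by rewrite strand_mapE //; apply/setP => u; rewrite !inE (same_connect along_sym' d'e).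
by have [d Td ->] := strand_repr sC; exists (f d); rewrite ?strand_mapE.
Qed.

(** A property confined to [T] ignores the discarded darts. This serves both for lying at a vertex
    and for lying at a given bar. *)
Lemma exists_strand_map (C : {set dart F}) (a' : pred (dart F')) (a : pred (dart F)) :
  C \in strands F -> (forall d, a' (f d) = a d) -> (forall d, a d -> d \in T) ->
  [exists d in strand_map C, a' d] = [exists d in C, a d].
Proof.
move=> sC faa aT; have [f' fK f'K] := f_bij.
apply/exists_inP/exists_inP => [[d'] Cd' ad'|[d] Cd ad].
  move: Cd' ad'; rewrite -[d']f'K faa => Cd' ad'.
  by exists (f' d') => //; rewrite -mem_strand_map // aT.
by exists (f d); rewrite ?mem_strand_map ?faa ?aT.
Qed.

Lemma at_kind_map k d : at_kind k (f d) = at_kind k d.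
Proof. by rewrite /at_kind f_base g_kind. Qed.

Lemma vertexT d : at_kind Vertex d -> d \in T.
Proof. by move=> kd; rewrite T_kind // (eqP kd). Qed.

Lemma bars_map C : C \in strands F -> bars (strand_map C) = bars C.
Proof.
move=> sC; rewrite /bars -(card_imset _ g_inj); apply: eq_card => x'.
have [g' gK g'K] := g_bij; rewrite -[x']g'K mem_imset // !inE g_kind.
case: eqP => //= kx; apply: exists_strand_map => // d.
  by rewrite f_base (inj_eq g_inj).
by move/eqP=> dx; rewrite T_kind // dx kx.
Qed.

Lemma sub_edges C : C \in edges F -> C \in strands F.
Proof. by rewrite inE => /andP[]. Qed.

Lemma mem_edges_map C : C \in strands F -> (strand_map C \in edges F') = (C \in edges F).
Proof.
move=> sC; rewrite !inE strands_map imset_f // sC /=.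
exact: exists_strand_map (at_kind_map _) (@vertexT).
Qed.

Lemma edges_map : edges F' = strand_map @: edges F.
Proof.
apply/setP => C'; apply/idP/imsetP => [eC'|[C eC ->]].
  have: C' \in strands F' by move: eC'; rewrite inE => /andP[].
  rewrite strands_map => /imsetP[C sC eqC]; exists C => //.
  by rewrite -mem_edges_map // -eqC.
by rewrite mem_edges_map // sub_edges.
Qed.

Lemma card_circles_map (p : pred nat) :
  #|[set C in circles F' | p (bars C)]| = #|[set C in circles F | p (bars C)]|.
Proof.
rewrite -(card_in_imset (f := strand_map)); last first.
  move=> C D; rewrite !inE => /andP[/andP[_ sC] _] /andP[/andP[_ sD] _].
  exact: strand_map_inj.
apply: eq_card => C'; apply/idP/imsetP => [|[C]].
  rewrite inE in_setD strands_map => /andP[/andP[eC']] /imsetP[C sC eqC] pC.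
  exists C => //; move: eC' pC; rewrite eqC mem_edges_map // bars_map // => eC pC.
  by rewrite inE in_setD eC sC.
case/setIdP=> /setDP[sC eC] pC ->.
by rewrite inE in_setD mem_edges_map // bars_map // eC strands_map imset_f.
Qed.

(** * Surfaces of corresponding spanning subgraphs *)

Section Subgraph.

Variable A : {set {set dart F}}.
Hypothesis sAE : A \subset edges F.
Let A' : {set {set dart F'}} := strand_map @: A.

Let sA C : C \in A -> C \in strands F.
Proof. by move/(subsetP sAE)/sub_edges. Qed.

Lemma mem_subgraph_map C : C \in strands F -> (strand_map C \in A') = (C \in A).
Proof.
move=> sC; apply/imsetP/idP => [[D AD /strand_map_inj ->]|AC] //; last by exists C.
exact: sA.
Qed.

Lemma band_map C h h' : C \in strands F ->
  band A' (strand_map C) (f h) (f h') = band A C h h'.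
Proof.
move=> sC; rewrite /band mem_subgraph_map // (inj_eq f_inj) !at_kind_map.
case kh: (at_kind Vertex h); rewrite ?andbF //=; last first.
case kh': (at_kind Vertex h'); rewrite ?andbF //.
by rewrite !mem_strand_map ?vertexT.
Qed.

(** Adjacency, band sides and orientability all ask for a band between two given ends whose number
    of bars satisfies a condition [p], trivial for adjacency. *)
Lemma exists_band_map (p : pred nat) h h' :
  [exists C, band A' C (f h) (f h') && p (bars C)]
    = [exists C, band A C h h' && p (bars C)].
Proof.
apply/existsP/existsP => [[C']|[C] /andP[bC pC]]; last first.
  have AC: C \in A by case/andP: bC.
  by exists (strand_map C); rewrite band_map ?bars_map ?sA ?bC.
case/andP=> bC pC; have /imsetP[C AC eqC]: C' \in A' by case/andP: bC.
by exists C; move: bC pC; rewrite eqC band_map ?bars_map ?sA // => ->.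
Qed.

Lemma band_end_map h : band_end A' (f h) = band_end A h.
Proof.
rewrite /band_end at_kind_map; case kh: (at_kind _ _) => //=.
apply/bigcupP/bigcupP => [[C'] /imsetP[C AC ->]|[C AC]] Ch.
  by exists C; rewrite // -mem_strand_map ?vertexT ?sA.
by exists (strand_map C); rewrite ?imset_f // mem_strand_map ?vertexT ?sA.
Qed.

Lemma adjacent_map x y : adjacent A' (g x) (g y) = adjacent A x y.
Proof.
have [f' fK f'K] := f_bij.
(* Moving the quantifier over [C] inside gives the form treated by [exists_band_map]. *)
have adjE G (B : {set {set dart G}}) u v : adjacent B u v =
    [exists h, exists h', [exists C, band B C h h' && predT (bars C)]
                          && ((base h == u) && (base h' == v))].
  apply/existsP/existsP => [[C /existsP[h /existsP[h' /and3P[b1 b2 b3]]]]|].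
    exists h; apply/existsP; exists h'; rewrite b2 b3 !andbT.
    by apply/existsP; exists C; rewrite b1.
  case=> h /existsP[h'] /andP[/existsP[C /andP[b1 _]] b2].
  by exists C; apply/existsP; exists h; apply/existsP; exists h'; rewrite b1.
rewrite !adjE; apply/existsP/existsP => -[h /existsP[h' hh']].
  exists (f' h); apply/existsP; exists (f' h'); move: hh'.
  by rewrite -[h]f'K -[h']f'K exists_band_map !f_base !(inj_eq g_inj) !fK.
exists (f h); apply/existsP; exists (f h').
by rewrite exists_band_map !f_base !(inj_eq g_inj).
Qed.

Lemma surf_k_map : surf_k A' = surf_k A.
Proof.
apply/esym/(n_comp_bij g_bij adjacent_map).
- exact/sym_connect_sym/adjacent_sym.
- exact/sym_connect_sym/adjacent_sym.
- exact: adjacent_closed.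
by move=> x; rewrite !inE g_kind.
Qed.

Lemma surf_n_map : surf_n A' = surf_n A.
Proof.
rewrite /surf_n surf_k_map card_in_imset => [|C D AC AD]; last first.
  by apply: strand_map_inj; rewrite ?sA.
congr (_ - _)%N; have [g' gK g'K] := g_bij; rewrite -(card_imset _ g_inj).
by apply: eq_card => x'; rewrite -[x']g'K mem_imset // !inE g_kind.
Qed.

(** [f] conjugates the rotations, so orbits have equal size and the band ends around a disk are
    listed in corresponding order. *)
Lemma next_end_map h : next_end A' (f h) = f (next_end A h).
Proof.
have ord_f : order (@rot F') (f h) = order (@rot F) h.
  rewrite /order -(card_image f_inj); apply: eq_card => d'.
  have [f' fK f'K] := f_bij; rewrite -[d']f'K mem_image // !inE.
  by apply: (connect_bij f_bij) => u v /=; rewrite f_rot (inj_eq f_inj).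
have traj_f n d : traject (@rot F') (f d) n = map f (traject (@rot F) d n).
  by elim: n d => //= n IHn d; rewrite f_rot IHn.
rewrite /next_end ord_f f_rot traj_f filter_map (eq_filter band_end_map).
by case: filter.
Qed.

Let fc (c : corner F) : corner F' := (f c.1, c.2).

Lemma boundary_step_map c c' : boundary_step A' (fc c) (fc c') = boundary_step A c c'.
Proof.
case: c c' => [h l] [h' l']; rewrite /boundary_step /disk_arc /= !band_end_map !next_end_map.
rewrite !(inj_eq f_inj); congr (_ || _).
exact: (exists_band_map (fun n => l' == (~~ l) (+) odd n)).
Qed.

Lemma surf_b_map : surf_b A' = surf_b A.
Proof.
have [f' fK f'K] := f_bij; congr (_ + _)%N.
  apply/esym; apply: (n_comp_bij (f := fc) _ boundary_step_map).
  - by exists (fun c => (f' c.1, c.2)); case=> h l; rewrite /fc /= ?fK ?f'K.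
  - exact/sym_connect_sym/boundary_step_sym.
  - exact/sym_connect_sym/boundary_step_sym.
  - exact: boundary_step_closed.
  by move=> c; rewrite !inE band_end_map.
rewrite -(card_imset _ g_inj); apply: eq_card => x'.
have [g' gK g'K] := g_bij; rewrite -[x']g'K mem_imset // !inE g_kind.
congr (_ && _); apply/forallP/forallP => all h.
  by have := all (f h); rewrite band_end_map f_base (inj_eq g_inj).
by rewrite -[h]f'K band_end_map f_base (inj_eq g_inj).
Qed.

Lemma surf_t_map : surf_t A' = surf_t A.
Proof.
have [f' fK f'K] := f_bij; have [g' gK g'K] := g_bij.
(* Orientations extend exactly when no band violates the parity condition, again an existence
   statement on bands. *)
have oriE G (B : {set {set dart G}}) (o : node G -> bool) :
    [forall C, forall h, forall h',
       band B C h h' ==> (o (base h) (+) o (base h') == odd (bars C))]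
  = [forall h, forall h', ~~ [exists C, band B C h h' &&
                          (o (base h) (+) o (base h') != odd (bars C))]].
  apply/forallP/forallP => all h.
    apply/forallP => h'; apply/existsPn => C; rewrite negb_and negbK -implybE.
    by have /forallP/(_ h)/forallP/(_ h') := all C.
  apply/forallP => u; apply/forallP => v; have /forallP/(_ v)/existsPn/(_ h) := all u.
  by rewrite negb_and negbK -implybE.
rewrite /surf_t; congr (nat_of_bool (~~ _)).
apply/existsP/existsP => -[o]; rewrite oriE => /forallP ori.
  exists [ffun x => o (g x)]; rewrite oriE; apply/forallP=> h; apply/forallP => h'.
  have /forallP/(_ (f h')) := ori (f h).
  by rewrite (exists_band_map (fun n => _ != odd n)) !f_base !ffunE.
exists [ffun x => o (g' x)]; rewrite oriE; apply/forallP=> h; apply/forallP => h'.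
have /forallP/(_ (f' h')) := ori (f' h).
rewrite -[h in X in _ -> X]f'K -[h' in X in _ -> X]f'K.
by rewrite (exists_band_map (fun n => _ != odd n)) !f_base !ffunE !gK.
Qed.

Lemma M_map (P : comNzRingType) (y z w : P) : M y z w A' = M y z w A.
Proof. by rewrite /M surf_k_map surf_n_map surf_b_map surf_t_map. Qed.

End Subgraph.

Lemma Q_map (P : comNzRingType) (y z w : P) : Q F' y z w = Q F y z w.
Proof.
rewrite /Q /odd_circles /even_circles.
rewrite (card_circles_map odd) (card_circles_map (fun n => ~~ odd n)); congr (_ * _)%R.
(* Preimage under [strand_map] among the edges of [F], where [strand_map] is injective; it inverts
   the passage from [A] to its image. *)
pose back (A' : {set {set dart F'}}) := [set C in edges F | strand_map C \in A'].
rewrite (reindex_onto (fun A : {set {set dart F}} => strand_map @: A) back) /=; last first.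
  move=> A' /subsetP sA'; apply/setP => C'; apply/imsetP/idP => [[C]|AC'].
    by rewrite inE => /andP[_ AC] ->.
  have: C' \in edges F' by apply: sA'.
  by rewrite edges_map => /imsetP[C eC eqC]; exists C; rewrite // inE eC -eqC.
apply: eq_big => [A|A /andP[_ /eqP <-]]; last first.
  by rewrite M_map //; apply/subsetP => C; rewrite inE => /andP[].
apply/andP/idP => [[_ /eqP <-]|sAE]; first by apply/subsetP => C; rewrite inE => /andP[].
split; first by rewrite edges_map imsetS.
apply/eqP/setP => C; rewrite inE; case eC: (C \in edges F).
  by rewrite mem_subgraph_map // sub_edges.
by apply/esym/negbTE/negP => /(subsetP sAE); rewrite eC.
Qed.

End Transfer.

(** * Crossings and marks in a rotation system *)

Section Rotation.

Variables (E : rotsys) (wfE : wellformed E).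
Implicit Type d : dart E.

Definition across d : dart E := rot (rot d).

Definition is_crossing d : bool := kindof (base d) \in [:: Classical; Virtual].

Lemma base_rot d : base (rot d) = base d.
Proof. by apply/esym/eqP; rewrite -(rot_node wfE) fconnect1. Qed.

Lemma order_rot d : order (@rot E) d = degree (base d).
Proof. by rewrite /order /degree; apply: eq_card => d'; rewrite !inE (rot_node wfE) eq_sym. Qed.

Lemma acrossK d : is_crossing d -> across (across d) = d.
Proof.
move=> cd; have := iter_order (rot_inj wfE) d.
by rewrite order_rot (degree_crossing wfE cd).
Qed.

Lemma rotK_mark d : kindof (base d) \in [:: Bar; Plain] -> across d = d.
Proof.
move=> cd; have := iter_order (rot_inj wfE) d.
by rewrite order_rot (degree_mark wfE cd).
Qed.

Lemma crossing_uniq d : is_crossing d ->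
  uniq [:: d; rot d; across d; rot (across d)].
Proof.
move=> cd; have := orbit_uniq (@rot E) d.
by rewrite /orbit order_rot (degree_crossing wfE cd).
Qed.

End Rotation.

(** * The move on darts *)

Section Slide.

Variables (E : rotsys) (wfE : wellformed E) (x y z : dart E).
Hypothesis xyz : triangle x y z.
Implicit Type d u : dart E.

Let baseR d : base (rot d) = base d := base_rot wfE d.
Let opp_x : opp x = rot y := esym (triangle_y xyz).
Let opp_y : opp y = rot z := esym (triangle_z xyz).
Let opp_z : opp z = rot x := esym (triangle_x xyz).
Let oppK : involutive (@opp E) := opp_invol wfE.
Let opp_rx : opp (rot x) = z. Proof. by rewrite -opp_z. Qed.
Let opp_ry : opp (rot y) = x. Proof. by rewrite -opp_x. Qed.
Let opp_rz : opp (rot z) = y. Proof. by rewrite -opp_y. Qed.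
Let oppE := (opp_x, opp_y, opp_z, opp_rx, opp_ry, opp_rz).

Let xy : base x != base y.
Proof.
apply/eqP => exy; have := classical_x xyz.
by rewrite /at_kind exy (eqP (virtual_y xyz)).
Qed.

Let xz : base x != base z.
Proof.
apply/eqP => exz; have := classical_x xyz.
by rewrite /at_kind exz (eqP (virtual_z xyz)).
Qed.

Let yz : base y != base z := corners_yz xyz.

Let cx : is_crossing x. Proof. by rewrite /is_crossing (eqP (classical_x xyz)). Qed.
Let cy : is_crossing y. Proof. by rewrite /is_crossing (eqP (virtual_y xyz)). Qed.
Let cz : is_crossing z. Proof. by rewrite /is_crossing (eqP (virtual_z xyz)). Qed.

Lemma innerE d :
  (d \in inner x y z) = (d \in [:: x; rot x; y; rot y; z; rot z]).
Proof.
rewrite !inE opp_x opp_y opp_z.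
by case: (d == x) (d == y) (d == z) (d == rot x) (d == rot y) (d == rot z) => [] [] [] [] [] [].
Qed.

Lemma inner_ind (p : dart E -> Prop) :
  p x -> p (rot x) -> p y -> p (rot y) -> p z -> p (rot z) ->
  forall u, u \in inner x y z -> p u.
Proof.
move=> px prx py pry pz prz u; rewrite innerE !inE.
by case/or4P => [|||/or3P[]] /eqP->.
Qed.

Lemma inner_opp u : (opp u \in inner x y z) = (u \in inner x y z).
Proof.
suff sub v : v \in inner x y z -> opp v \in inner x y z.
  by apply/idP/idP => /sub; rewrite ?oppK.
by elim/inner_ind; rewrite ?oppE innerE !inE eqxx ?orbT.
Qed.

Lemma inner_crossing u : u \in inner x y z -> is_crossing u.
Proof. by elim/inner_ind; rewrite // /is_crossing baseR. Qed.

Lemma inner_acrossK u : u \in inner x y z -> across (across u) = u.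
Proof. by move/inner_crossing/(acrossK wfE). Qed.

Let neq_base d d' : base d != base d' -> (d == d') = false.
Proof. by move=> neq; apply: contra_neqF neq => /eqP ->. Qed.

(** The two inner darts at a corner are consecutive in the rotation, and the three corners are
    distinct nodes. *)
Lemma across_inner u : u \in inner x y z -> across u \notin inner x y z.
Proof.
have yx := xy; rewrite eq_sym in yx; have zx := xz; rewrite eq_sym in zx.
have zy := yz; rewrite eq_sym in zy.
have sep (v : dart E) : is_crossing v ->
  [/\ (rot (rot v) == v) = false, (rot (rot v) == rot v) = false,
   (rot (rot (rot v)) == v) = false & (rot (rot (rot v)) == rot v) = false].
  move/(crossing_uniq wfE); rewrite /across /= !inE !negb_or.
  case/and4P=> /and3P[_ n1 n2] /andP[n3 n4] _ _.
  by split; apply/negbTE; rewrite eq_sym.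
have [x1 x2 x3 x4] := sep x cx; have [y1 y2 y3 y4] := sep y cy.
have [z1 z2 z3 z4] := sep z cz.
by elim/inner_ind; rewrite innerE !inE /across
  ?x1 ?x2 ?x3 ?x4 ?y1 ?y2 ?y3 ?y4 ?z1 ?z2 ?z3 ?z4 /= !neq_base ?baseR //.
Qed.

Let ex := exchange x y z.

Lemma exchange_inner u : u \in inner x y z -> ex u = across (opp u).
Proof. by rewrite /ex /exchange => ->. Qed.

Lemma exchange_outer u : u \in inner x y z -> ex (across u) = opp u.
Proof.
move=> iu; rewrite /ex /exchange (negbTE (across_inner iu)).
by rewrite -/(across (across u)) inner_acrossK // iu.
Qed.

(** The exchange swaps each inner dart [u] with [across (opp u)] and fixes all other darts. So
    [slide_opp] is a conjugate of [opp]. *)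
Lemma exchangeK : involutive ex.
Proof.
move=> d; case id: (d \in inner x y z).
  by rewrite (exchange_inner id) exchange_outer ?inner_opp ?oppK.
case iu: (across d \in inner x y z); last by rewrite /ex /exchange !(id, iu).
have dK : across (across d) = d.
  by rewrite acrossK //; have := inner_crossing iu; rewrite /is_crossing !baseR.
by rewrite -dK exchange_outer // exchange_inner ?inner_opp ?oppK.
Qed.

Definition slide_opp d : dart E := ex (opp (ex d)).

Lemma slide_oppK : involutive slide_opp.
Proof. by move=> d; rewrite /slide_opp exchangeK oppK exchangeK. Qed.

(** Ends that pointed out of the triangle bound the middle segment of their strand after the
    move. *)
Lemma slide_opp_across u : u \in inner x y z ->
  slide_opp (across u) = across (opp u).
Proof. by move=> iu; rewrite /slide_opp exchange_outer // oppK exchange_inner. Qed.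

(** * Strands before and after the move *)

Variable t : dart E -> dart E.
Hypotheses (tK : involutive t) (t_virtual : forall d, at_kind Virtual d -> t d = across d).

(** For [t] the passage through nodes, this is the strand relation. Since [t] is prescribed at
    virtual crossings only, all three spins at the classical corner are treated at once. *)
Definition step (o : dart E -> dart E) : rel (dart E) :=
  [rel d d' | (d' == o d) || (d' == t d)].

Lemma step_sym o : involutive o -> symmetric (step o).
Proof.
by move=> oK d d' /=; congr (_ || _); rewrite eq_sym inv_eq.
Qed.

Notation c1 := (connect (step (@opp E))).
Notation c2 := (connect (step slide_opp)).

Let c1C : connect_sym (step (@opp E)) := sym_connect_sym (step_sym oppK).
Let c2C : connect_sym (step slide_opp) := sym_connect_sym (step_sym slide_oppK).

Let c1_opp d : c1 d (opp d). Proof. by rewrite connect1 /step //= eqxx. Qed.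
Let c2_opp d : c2 d (slide_opp d). Proof. by rewrite connect1 /step //= eqxx. Qed.
Let c1_t d : c1 d (t d). Proof. by rewrite connect1 /step //= eqxx orbT. Qed.
Let c2_t d : c2 d (t d). Proof. by rewrite connect1 /step //= eqxx orbT. Qed.

Let passes v d := (d == v) || (d == across v).

Let passesE v d : is_crossing v -> passes v (across d) = passes v d.
Proof.
move=> cv; have ac_inj : injective (@across E) by move=> a b /(rot_inj wfE)/(rot_inj wfE).
by rewrite /passes -{1}(acrossK wfE cv) !(inj_eq ac_inj) orbC.
Qed.

Let cry : is_crossing (rot y). Proof. by rewrite /is_crossing baseR. Qed.

Let passesT v : passes v v. Proof. by rewrite /passes eqxx. Qed.

Let passes_base v d : base d != base v -> passes v d = false.
Proof. by move=> neq; rewrite /passes !neq_base // /across !baseR. Qed.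

Let passes_rot v : is_crossing v -> passes (rot v) v = false.
Proof.
move/(crossing_uniq wfE); rewrite /= !inE !negb_or.
by case/andP=> /and3P[n1 _ n2] _; rewrite /passes (negbTE n1) (negbTE n2).
Qed.

Let rot_passes v : is_crossing v -> passes v (rot v) = false.
Proof.
move/(crossing_uniq wfE); rewrite /= !inE !negb_or.
case/and3P=> /and3P[n1 _ _] /andP[n2 _] _.
by rewrite /passes (negbTE n2) eq_sym (negbTE n1).
Qed.

Let passes_y : (passes (rot y) x = false) * (passes (rot y) (rot x) = false) *
  (passes (rot y) y = false) * (passes (rot y) (rot y) = true) *
  (passes (rot y) z = false) * (passes (rot y) (rot z) = false).
Proof.
by do !split; rewrite ?passesT ?passes_rot // passes_base ?baseR // eq_sym.
Qed.

Let passes_z : (passes z x = false) * (passes z (rot x) = false) *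
  (passes z y = false) * (passes z (rot y) = false) *
  (passes z z = true) * (passes z (rot z) = false).
Proof. by do !split; rewrite ?passesT ?rot_passes // passes_base ?baseR. Qed.

(** Discarded are the ends, at the two virtual corners, of the strands through the sides [x] and
    [z]; the ends of the moving strand there stay. *)
Definition kept : {pred dart E} := [pred d | ~~ (passes (rot y) d || passes z d)].

Lemma passes_t v d : at_kind Virtual v -> passes v (t d) = passes v d.
Proof.
move=> kv; have cv : is_crossing v by rewrite /is_crossing (eqP kv).
have sub u : passes v u -> passes v (t u).
  move=> pu; have ku : at_kind Virtual u.
    by case/orP: pu => /eqP->; rewrite /at_kind /across ?baseR.
  by rewrite t_virtual // passesE.
by apply/idP/idP => /sub; rewrite ?tK.
Qed.

(** * Retractions that discard the four virtual darts *)

Section Retract.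

Variables (o : dart E -> dart E) (a b : dart E).
Let r d := if passes (rot y) d then a else if passes z d then b else d.

Lemma retract_kept d : d \in kept -> r d = d.
Proof. by rewrite inE negb_or /r => /andP[/negbTE-> /negbTE->]. Qed.

(** [t] preserves each discarded pair, on which [r] is constant; elsewhere [r] is the identity and
    [t] is a step. *)
Lemma retract_t d : connect (step o) (r d) (r (t d)).
Proof.
have kry : at_kind Virtual (rot y) by rewrite /at_kind baseR // (eqP (virtual_y xyz)).
rewrite /r !passes_t //; last exact: virtual_z xyz.
by case: ifP => // _; case: ifP => // _; rewrite connect1 /step //= eqxx orbT.
Qed.

End Retract.

(* In the original diagram the ends of the two crossings of the moving strand on
   the strand through [x], resp. [z], are joined to [x], resp. [rot x]; after the
   move they are joined to the ends opposite to these. *)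
Let r1 d := if passes (rot y) d then x else if passes z d then rot x else d.
Let r2 d := if passes (rot y) d then across x else if passes z d then across (rot x) else d.

Let r1E : (r1 x = x) * (r1 (rot x) = rot x) * (r1 y = y) * (r1 (rot y) = x) *
  (r1 z = rot x) * (r1 (rot z) = rot z).
Proof. by do !split; rewrite /r1 ?passes_y ?passes_z. Qed.

Let r1aE : (r1 (across x) = across x) * (r1 (across (rot x)) = across (rot x)) *
  (r1 (across y) = across y) * (r1 (across (rot y)) = x) *
  (r1 (across z) = rot x) * (r1 (across (rot z)) = across (rot z)).
Proof. by do !split; rewrite /r1 !passesE // ?passes_y ?passes_z. Qed.

Let r2E : (r2 x = x) * (r2 (rot x) = rot x) * (r2 y = y) * (r2 (rot y) = across x) *
  (r2 z = across (rot x)) * (r2 (rot z) = rot z).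
Proof. by do !split; rewrite /r2 ?passes_y ?passes_z. Qed.

Let r2aE : (r2 (across x) = across x) * (r2 (across (rot x)) = across (rot x)) *
  (r2 (across y) = across y) * (r2 (across (rot y)) = across x) *
  (r2 (across z) = across (rot x)) * (r2 (across (rot z)) = across (rot z)).
Proof. by do !split; rewrite /r2 !passesE // ?passes_y ?passes_z. Qed.

Let virtual_inner u : u \in [:: y; rot y; z; rot z] -> at_kind Virtual u.
Proof.
by rewrite !inE => /or4P[] /eqP->; rewrite /at_kind ?baseR //;
  [exact: virtual_y xyz | exact: virtual_y xyz | exact: virtual_z xyz | exact: virtual_z xyz].
Qed.

Let c1_across u : u \in [:: y; rot y; z; rot z] -> c1 u (across u).
Proof. by move/virtual_inner/t_virtual <-. Qed.

(** The path goes straight through the virtual corner by [t], then along the new middle segment. *)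
Let c2_across u : u \in [:: y; rot y; z; rot z] -> c2 u (across (opp u)).
Proof.
move=> vu; have iu : u \in inner x y z by rewrite innerE 2!inE vu !orbT.
by rewrite -slide_opp_across // -t_virtual ?virtual_inner // (connect_trans (c2_t u)).
Qed.

Let outer d : d \notin inner x y z -> (exists2 u, u \in inner x y z & d = across u) \/ ex d = d.
Proof.
move=> nd; case iu: (across d \in inner x y z); last first.
  by right; rewrite /ex /exchange (negbTE nd) iu.
left; exists (across d); rewrite // acrossK //.
by have := inner_crossing iu; rewrite /is_crossing !baseR.
Qed.

Let passes_outer v d : v \in inner x y z ->
  d \notin inner x y z -> ex d = d -> passes v d = false.
Proof.
move=> iv nd exd; apply/negP => /orP[]/eqP dv; first by rewrite dv iv in nd.
by move: nd; rewrite -exd dv exchange_outer // inner_opp iv.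
Qed.

Let iry : rot y \in inner x y z. Proof. by rewrite innerE !inE eqxx !orbT. Qed.
Let iz : z \in inner x y z. Proof. by rewrite innerE !inE eqxx !orbT. Qed.

(** The sides [x] and [z] collapse to a point each, and the ends of the side [y] stay on the moving
    strand. For a segment outside of the triangle, both ends are compared with their images under
    [ex], which [slide_opp] joins. *)
Lemma retract1_opp d : c2 (r1 d) (r1 (opp d)).
Proof.
(* From [rot z] the path goes straight across its corner, along the new middle segment to
   [across y], and straight across to [y]. *)
have c2_y : c2 y (rot z).
  rewrite c2C (connect_trans (c2_across _)) ?inE ?eqxx ?orbT // opp_rz c2C.
  by rewrite -t_virtual ?virtual_inner ?inE ?eqxx.
case id: (d \in inner x y z).
  by move: id; elim/inner_ind; rewrite ?oppE ?r1E // c2C.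
(* For the two far ends retracted to [x] and [rot x] both sides agree; the other four are reached by
   [c2_across] from the inner dart exchanged with them. *)
have main e : e \notin inner x y z -> c2 (ex e) (r1 e).
  move=> ie; case: (outer ie) => [[u iu ->{e ie}]|eK].
    rewrite exchange_outer //; move: iu; elim/inner_ind; rewrite ?oppE ?r1aE //.
    - by rewrite -opp_ry c2_across ?inE ?eqxx ?orbT.
    - by rewrite -opp_z c2_across ?inE ?eqxx ?orbT.
    - by rewrite -opp_rz c2_across ?inE ?eqxx ?orbT.
    by rewrite -opp_y c2_across ?inE ?eqxx ?orbT.
  by rewrite eK /r1 !passes_outer.
rewrite c2C -(same_connect c2C (main _ _)) ?inner_opp ?id // c2C.
rewrite -(same_connect c2C (main _ _)) ?id //.
by have := c2_opp (ex d); rewrite /slide_opp exchangeK.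
Qed.

Lemma retract2_opp d : c1 (r2 d) (r2 (slide_opp d)).
Proof.
have c1_oa u : u \in [:: y; rot y; z; rot z] -> c1 (opp u) (across u).
  by move=> vu; apply: connect_trans (c1_across vu); rewrite c1C.
(* Writing the dart as [ex e] turns a segment of the new diagram into one of the old diagram, with
   ends [e] and [opp e]. *)
have [e ->] : exists e, d = ex e by exists (ex d); rewrite exchangeK.
rewrite /slide_opp exchangeK => {d}; move: e => d.
case id: (d \in inner x y z).
  rewrite !exchange_inner ?inner_opp // oppK.
  (* Before the move the far ends of the moving strand are joined through both virtual corners and
     the side [y]. *)
  have c1_y : c1 (across y) (across (rot z)).
    rewrite c1C -opp_y -(same_connect_r c1C (c1_across _)) ?inE ?eqxx // c1C.
    rewrite opp_y -{1}opp_rz c1_oa ?inE ?eqxx ?orbT //.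
  by move: id; elim/inner_ind; rewrite ?oppE ?r2aE // c1C.
have main e : e \notin inner x y z -> c1 (r2 (ex e)) e.
  move=> ie; case: (outer ie) => [[u iu ->{e ie}]|eK].
    rewrite exchange_outer //; move: iu; elim/inner_ind; rewrite ?oppE ?r2E //.
    - by rewrite -opp_y c1_oa ?inE ?eqxx ?orbT.
    - by rewrite -{1}opp_ry c1_oa ?inE ?eqxx ?orbT.
    - by rewrite -opp_z c1_oa ?inE ?eqxx ?orbT.
    by rewrite -{1}opp_rz c1_oa ?inE ?eqxx ?orbT.
  by rewrite eK /r2 !passes_outer.
rewrite (same_connect c1C (main _ _)) ?id // c1C.
by rewrite (same_connect c1C (main _ _)) ?inner_opp ?id // c1C.
Qed.

(** [r1] and [r2] fix the kept darts and send each step in one diagram to a connection in the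
    other. *)
Lemma slide_connect : {in kept &, forall d e, c2 d e = c1 d e}.
Proof.
move=> d e kd ke; apply/idP/idP => cde.
  rewrite -[d](retract_kept (across x) (across (rot x)) kd).
  rewrite -[e](retract_kept (across x) (across (rot x)) ke).
  apply: (connect_homo (f := r2)) cde => u v /orP[] /eqP ->; first exact: retract2_opp.
  exact: retract_t.
rewrite -[d](retract_kept x (rot x) kd) -[e](retract_kept x (rot x) ke).
apply: (connect_homo (f := r1)) cde => u v /orP[] /eqP ->; first exact: retract1_opp.
exact: retract_t.
Qed.

(** A discarded dart lies on the strand of [x] or of [rot x], which sit at the classical corner and
    are kept. *)
Lemma kept_meets d : exists2 e, e \in kept & c1 d e.
Proof.
have c1y : c1 (rot y) x by rewrite -opp_ry.
have c1z : c1 z (rot x) by rewrite -opp_z.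
case py: (passes (rot y) d); last case pz: (passes z d); last first.
- by exists d; rewrite // inE py pz.
- exists (rot x); first by rewrite inE passes_y passes_z.
  case/orP: pz => /eqP-> //; rewrite (connect_trans _ c1z) // c1C.
  by rewrite c1_across ?inE ?eqxx ?orbT.
exists x; first by rewrite inE passes_y passes_z.
case/orP: py => /eqP-> //; rewrite (connect_trans _ c1y) // c1C.
by rewrite c1_across ?inE ?eqxx ?orbT.
Qed.

(** After the move [across x] and [across (rot x)] take over the part of [x] and [rot x]. *)
Lemma kept_meets_slide d : exists2 e, e \in kept & c2 d e.
Proof.
have c2y : c2 (rot y) (across x) by rewrite -opp_ry c2_across ?inE ?eqxx ?orbT.
have c2z : c2 z (across (rot x)) by rewrite -opp_z c2_across ?inE ?eqxx ?orbT.
case py: (passes (rot y) d); last case pz: (passes z d); last first.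
- by exists d; rewrite // inE py pz.
- exists (across (rot x)); first by rewrite inE !passesE ?passes_y ?passes_z.
  case/orP: pz => /eqP-> //; rewrite (connect_trans _ c2z) // c2C.
  by rewrite -t_virtual ?virtual_inner ?inE ?eqxx ?orbT.
exists (across x); first by rewrite inE !passesE ?passes_y ?passes_z.
case/orP: py => /eqP-> //; rewrite (connect_trans _ c2y) // c2C.
by rewrite -t_virtual ?virtual_inner ?inE ?eqxx ?orbT.
Qed.

Lemma nonvirtual_kept d : ~~ at_kind Virtual d -> d \in kept.
Proof.
apply: contraR; rewrite inE negbK /at_kind => /orP[] /orP[] /eqP->; rewrite /across ?baseR //.
all: first [exact: virtual_y xyz | exact: virtual_z xyz].
Qed.

End Slide.

(** * Passage through the nodes of a state *)

Section SpinAt.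

Variables (E : rotsys) (s : spins E).

Lemma spin_at_classical (c : crossing E) : spin_at s (val c) = Some (s c).
Proof. by rewrite /spin_at valK. Qed.

Lemma spin_at_none n : kindof n != Classical -> spin_at s n = None.
Proof. by move=> kn; rewrite /spin_at insubN. Qed.

Lemma state_kind_none n : kindof n != Classical -> state_kind s n = kindof n.
Proof. by move=> kn; rewrite /state_kind spin_at_none. Qed.

End SpinAt.

Section StateStrands.

Variables (E : rotsys) (wfE : wellformed E) (s : spins E).

Lemma thru_state_virtual (d : dart E) :
  at_kind Virtual d -> @thru (state s) d = across d.
Proof.
move=> /eqP kd; have rotE e : base e = base d -> state_rot s e = rot e.
  by move=> ed; rewrite /state_rot ed spin_at_none ?kd.
by rewrite /thru /= state_kind_none kd // !rotE // base_rot.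
Qed.

(** Strands stop at vertices; elsewhere away from classical crossings, the passage is [across] at
    degree 4 or [rot] at degree 2. At a smoothed crossing [over] alternates, so the second passage
    is a quarter turn in the opposite sense. *)
Lemma thru_stateK : involutive (@thru (state s)).
Proof.
suff inv (d : dart E) : @thru (state s) (@thru (state s) d) = d by [].
have bR := base_rot wfE.
have [kd|kd] := boolP (kindof (base d) == Classical); last first.
  have rotE e : base e = base d -> state_rot s e = rot e.
    by move=> ed; rewrite /state_rot ed spin_at_none.
  have thruE e : base e = base d -> @thru (state s) e =
      match kindof (base d) with Vertex => e | Classical | Virtual => across e | _ => rot e end.
    move=> ed; rewrite /thru /= ed state_kind_none //.
    by rewrite !rotE ?bR.
  rewrite [X in thru X]thruE // thruE; last by case: kindof; rewrite /across ?bR.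
  case kE: (kindof (base d)) => //; first by rewrite kE in kd.
  - by rewrite acrossK // /is_crossing kE.
  - by apply: (rotK_mark wfE); rewrite kE.
  by apply: (rotK_mark wfE); rewrite kE.
have cd : is_crossing d by rewrite /is_crossing (eqP kd).
have rot4 : rot (rot (rot (rot d))) = d := acrossK wfE cd.
have ov e : base e = base d -> over (rot e) = ~~ over e.
  by move=> ed; apply: (over_alternates wfE); rewrite /at_kind ed.
pose c : crossing E := Sub (base d) kd.
have sd : spin_at s (base d) = Some (s c) by rewrite -(spin_at_classical s c).
have kind_d : state_kind s (base d) = if s c is Zero then Vertex else Plain.
  by rewrite /state_kind sd; case: (s c).
have rot_d e : base e = base d -> state_rot s e =
    match s c with Pos => if over e then rot (rot (rot e)) else rot e
    | Neg => if over e then rot e else rot (rot (rot e)) | Zero => rot e end.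
  by move=> ed; rewrite /state_rot ed sd; case: (s c).
have thruE e : base e = base d -> @thru (state s) e =
  if s c is Zero then e else state_rot s e.
  by move=> ed; rewrite /thru /= ed kind_d; case: (s c).
have b_d e : base e = base d -> base (state_rot s e) = base d.
  by move=> ed; rewrite rot_d //; case: (s c); case: (over e); rewrite ?bR.
rewrite [X in thru X]thruE // thruE; last by case: (s c); rewrite ?b_d.
have := rot_d d erefl; case: (s c) (rot_d) => // rotE ->.
  all: by case o: (over d); rewrite rotE ?bR // ?ov ?bR // o /= rot4.
Qed.

End StateStrands.

(** * Corresponding states and the sum over spins *)

Section Invariance.

Variables (E E' : rotsys) (wfE : wellformed E) (wfE' : wellformed E').
Variables (x y z : dart E) (f : dart E -> dart E') (g : node E -> node E').
Hypothesis xyz : triangle x y z.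
Hypotheses (f_bij : bijective f) (g_bij : bijective g).
Hypothesis f_base : forall d, base (f d) = g (base d).
Hypothesis f_opp : forall d, opp (f d) = f (slide_opp x y z d).
Hypothesis f_rot : forall d, rot (f d) = f (rot d).
Hypothesis g_kind : forall n, kindof (g n) = kindof n.
Hypothesis f_over : forall d, at_kind Classical d -> over (f d) = over d.

Lemma g_crossing (c : crossing E) : kindof (g (val c)) == Classical.
Proof. by rewrite g_kind (valP c). Qed.

Definition crossing_map (c : crossing E) : crossing E' := Sub (g (val c)) (g_crossing c).

Lemma crossing_map_bij : bijective crossing_map.
Proof.
have [g' gK g'K] := g_bij.
have kg' (c : crossing E') : kindof (g' (val c)) == Classical.
  by rewrite -g_kind g'K (valP c).
exists (fun c => Sub (g' (val c)) (kg' c) : crossing E) => c; apply: val_inj.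
  by rewrite /= gK.
by rewrite /= g'K.
Qed.

Definition pull_spins (s' : spins E') : spins E := [ffun c => s' (crossing_map c)].

Lemma pull_spins_bij : bijective pull_spins.
Proof.
have [h' hK h'K] := crossing_map_bij.
exists (fun s : spins E => [ffun c => s (h' c)]) => s; apply/ffunP => c; rewrite !ffunE.
  by rewrite h'K.
by rewrite hK.
Qed.

Lemma spin_sum_pull (s' : spins E') : spin_sum (pull_spins s') = spin_sum s'.
Proof.
have cardE v : #|[set c | pull_spins s' c == v]| = #|[set c | s' c == v]|.
  have [h' hK h'K] := crossing_map_bij.
  rewrite -(card_imset _ (can_inj hK)); apply: eq_card => c.
  by rewrite -[c]h'K (mem_imset _ _ (can_inj hK)) !inE ffunE.
by rewrite /spin_sum !cardE.
Qed.

Section State.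

Variable s' : spins E'.
Let s : spins E := pull_spins s'.

Lemma spin_at_pull n : spin_at s' (g n) = spin_at s n.
Proof.
have [kn|kn] := boolP (kindof n == Classical); last first.
  by rewrite !spin_at_none ?g_kind.
pose c : crossing E := Sub n kn.
rewrite -[n]/(val c) spin_at_classical -[g _]/(val (crossing_map c)).
by rewrite spin_at_classical ffunE.
Qed.

Lemma state_kind_map n : state_kind s' (g n) = state_kind s n.
Proof. by rewrite /state_kind spin_at_pull g_kind. Qed.

Lemma state_rot_map d : state_rot s' (f d) = f (state_rot s d).
Proof.
rewrite /state_rot f_base spin_at_pull; case sd: (spin_at s (base d)) => [v|]; last exact: f_rot.
(* A spin is recorded at classical crossings only, where [f_over] applies. *)
have kd : at_kind Classical d.
  by apply: contraT => /(spin_at_none s); rewrite sd.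
by rewrite f_over //=; case: v {sd}; case: (over d); rewrite !f_rot.
Qed.

Lemma thru_map d : @thru (state s') (f d) = f (@thru (state s) d).
Proof.
by rewrite /thru /= f_base state_kind_map; case: state_kind; rewrite ?state_rot_map.
Qed.

(** The move alters only [opp], and [thru] corresponds under [f]; so the strand relation of
    [state s'] pulls back to [step] with [slide_opp], and [Q_map] applies with the kept darts as
    [T]. *)
Lemma Q_state_map (P : comNzRingType) (a b c : P) :
  Q (state s) a b c = Q (state s') a b c.
Proof.
have tK := @thru_stateK _ wfE s; have tV := @thru_state_virtual _ wfE s.
have along_f d e : @along (state s') (f d) (f e)
    = step (@thru (state s)) (slide_opp x y z) d e.
  by rewrite /along /step /= f_opp thru_map !(inj_eq (bij_inj f_bij)).
have connect_f := connect_bij f_bij along_f.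
apply/esym.
apply: (@Q_map (state s) (state s') f g (kept y z)) => //.
- exact: state_rot_map.
- exact: state_kind_map.
- exact/sym_connect_sym/(step_sym tK)/(opp_invol wfE).
- exact/sym_connect_sym/(step_sym (@thru_stateK _ wfE' s'))/(opp_invol wfE').
- by move=> d e kd ke; rewrite connect_f (slide_connect wfE xyz tK tV).
- move=> d; refine (kept_meets wfE xyz tK tV d).
- move=> d'; have [f' _ f'K] := f_bij.
  have [e ke de] := kept_meets_slide wfE xyz tK tV (f' d').
  by exists e; rewrite // -[d']f'K connect_f.
(* Virtual nodes stay virtual in every state, so darts at its vertices and bars are kept. *)
move=> d kd; apply: (nonvirtual_kept wfE xyz); apply/negP => /eqP dV.
by move: kd; rewrite /= state_kind_none dV.
Qed.

End State.

End Invariance.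

Lemma R_slide (E E' : diagram) (x y z : dart E) (f : dart E -> dart E')
    (g : node E -> node E') :
  triangle x y z -> bijective f -> bijective g ->
  (forall d, base (f d) = g (base d)) ->
  (forall d, opp (f d) = f (slide_opp x y z d)) ->
  (forall d, rot (f d) = f (rot d)) ->
  (forall n, kindof (g n) = kindof n) ->
  (forall d, at_kind Classical d -> over (f d) = over d) ->
  R E = R E'.
Proof.
move=> xyz f_bij g_bij f_base f_opp f_rot g_kind f_over.
rewrite /R (reindex _ (onW_bij _ (pull_spins_bij g_bij g_kind))) /=.
apply: eq_bigr => s' _; rewrite (spin_sum_pull g_bij); congr (_ *: _)%R.
exact: (Q_state_map (codeP E) (codeP E') xyz f_bij g_bij f_base f_opp f_rot g_kind f_over).
Qed.

Theorem proposition6p11 (E E' : diagram) : Vstar E E' -> R E = R E'.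
Proof.
case=> x [y [z [xyz [f [g [f_bij g_bij [f_base f_opp f_rot g_kind f_over]]]]]]].
exact: (R_slide xyz f_bij g_bij f_base f_opp f_rot g_kind f_over).
Qed.
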